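(* Let $R$ be a weakly reversible ring. Then the lower nil-radical of $R$ coincides with the set of nilpotent elements of $R$, i.e., $Nil_*(R)=Nil(R)$; in other words, $R$ is $2$-primal.
   Context: All rings are associative with identity, not necessarily commutative. For $a\in R$, $r_R(a)=\{b\in R: ab=0\}$ and $l_R(a)=\{b\in R: ba=0\}$. An element $a\in R$ is reversible if $l_R(a)=r_R(a)$. A ring $R$ is weakly reversible if for each non-zero $a\in R$ there is an integer $m>0$ such that $a^m$ is a non-zero reversible element of $R$. $Nil_*(R)$ denotes the intersection of all prime ideals of $R$ (the lower nil-radical), and $Nil(R)$ the set of all nilpotent elements of $R$. A ring is $2$-primal if $Nil_*(R)=Nil(R)$. *)

(* Defs.v *)
From mathcomp Require Import all_boot all_algebra.
From mathcomp Require Import boolp classical_sets.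

Set Implicit Arguments.
Unset Strict Implicit.
Unset Printing Implicit Defensive.

Import GRing.Theory.

Local Open Scope classical_set_scope.
Local Open Scope ring_scope.

(* Rings are [pzRingType]s: associative and unital, not necessarily
   commutative, with the zero ring allowed. *)

Definition left_annihilator (R : pzRingType) (a : R) : set R :=
  [set b | b * a = 0].

Definition right_annihilator (R : pzRingType) (a : R) : set R :=
  [set b | a * b = 0].

Definition reversible_elt (R : pzRingType) (a : R) : Prop :=
  left_annihilator a = right_annihilator a.

Definition weakly_reversible (R : pzRingType) : Prop :=
  forall a : R, a != 0 ->
    exists m : nat, [/\ (0 < m)%N, a ^+ m != 0 & reversible_elt (a ^+ m)].

Definition two_sided_ideal (R : pzRingType) (I : set R) : Prop :=
  [/\ I 0,
      forall x y, I x -> I y -> I (x - y),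
      forall r x, I x -> I (r * x)
    & forall x r, I x -> I (x * r)].

(* The product ideal: finite sums of products, given by lists of pairs. *)
Definition ideal_mul (R : pzRingType) (I J : set R) : set R :=
  [set x | exists2 s : seq (R * R),
             (forall p, p \in s -> I p.1 /\ J p.2)
           & x = \sum_(p <- s) p.1 * p.2].

(* Primeness for noncommutative rings is tested on products of two-sided
   ideals; the elementwise condition (as in [prime_idealr_closed] of
   mathcomp's [ring_quotient]) would define completely prime ideals. *)
Definition prime_ideal (R : pzRingType) (P : set R) : Prop :=
  [/\ two_sided_ideal P,
      P != setT
    & forall I J : set R, two_sided_ideal I -> two_sided_ideal J ->
        ideal_mul I J `<=` P -> I `<=` P \/ J `<=` P].

(* For the zero ring, which has no prime ideal, this is the whole ring. *)
Definition lower_nilradical (R : pzRingType) : set R :=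
  \bigcap_(P in [set P : set R | prime_ideal P]) P.
Arguments lower_nilradical : clear implicits.

Definition nilpotent_elts (R : pzRingType) : set R :=
  [set a | exists2 n : nat, (0 < n)%N & a ^+ n = 0].
Arguments nilpotent_elts : clear implicits.

Definition two_primal (R : pzRingType) : Prop :=
  lower_nilradical R = nilpotent_elts R.

(* Main.v *)
Require Import Defs.
From mathcomp Require Import all_boot all_algebra.
From mathcomp Require Import boolp classical_sets.

(** [Nil R `<=` Nil_* R]: in a weakly reversible ring a square-zero element is
    reversible, so its left annihilator, being equal to its right annihilator,
    is a two-sided ideal.  If [a * a ^+ k * x * a = 0], then
    [z = a ^+ k * x * a] is killed by [a] on the left, hence [z * z = 0],
    hence [z * R * a = 0].  Each such step trades one factor of [a ^+ k] for
    a factor [R * a] on the right, so [a ^+ n = 0] ends in [a * R * a ... R * a = 0],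
    and every prime ideal contains [a].

    [Nil_* R `<=` Nil R]: an ideal maximal among those containing no power of
    a non-nilpotent [a] is prime. *)

Set Implicit Arguments.
Unset Strict Implicit.
Unset Printing Implicit Defensive.

Import GRing.Theory.

Local Open Scope classical_set_scope.
Local Open Scope ring_scope.

Section Ideals.
Variable R : pzRingType.
Implicit Types (a b x y z : R) (I J P : set R).

Lemma two_sided_idealD I x y : two_sided_ideal I -> I x -> I y -> I (x + y).
Proof.
move=> [I0 IB _ _] Ix Iy; rewrite -[y]opprK; apply: (IB _ _ Ix).
by rewrite -[- y]add0r; apply: IB.
Qed.

Lemma two_sided_ideal_sum I (T : eqType) (s : seq T) (F : T -> R) :
  two_sided_ideal I -> (forall i, i \in s -> I (F i)) -> I (\sum_(i <- s) F i).
Proof.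
move=> idI IF; rewrite big_seq; elim/big_ind: _ => //; first by case: idI.
by move=> x y; apply: two_sided_idealD.
Qed.

Definition ideal_add I J : set R :=
  [set z | exists x y, [/\ I x, J y & z = x + y]].

Lemma two_sided_ideal_add I J :
  two_sided_ideal I -> two_sided_ideal J -> two_sided_ideal (ideal_add I J).
Proof.
move=> [I0 IB IL IR] [J0 JB JL JR]; split.
- by exists 0, 0; rewrite addr0.
- move=> _ _ [x [y [Ix Jy ->]]] [x' [y' [Ix' Jy' ->]]].
  exists (x - x'), (y - y'); split; [exact: IB|exact: JB|].
  by rewrite opprD addrACA.
- move=> r _ [x [y [Ix Jy ->]]].
  by exists (r * x), (r * y); split; [exact: IL|exact: JL|exact: mulrDr].
- move=> _ r [x [y [Ix Jy ->]]].
  by exists (x * r), (y * r); split; [exact: IR|exact: JR|exact: mulrDl].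
Qed.

Definition principal_ideal a : set R :=
  [set x | exists s : seq (R * R), x = \sum_(p <- s) p.1 * a * p.2].

Lemma two_sided_principal_ideal a : two_sided_ideal (principal_ideal a).
Proof.
split.
- by exists [::]; rewrite big_nil.
- move=> _ _ [s ->] [t ->]; exists (s ++ [seq (- p.1, p.2) | p <- t]).
  rewrite big_cat big_map -sumrN; congr (_ + _).
  by apply: eq_bigr => p _; rewrite /= !mulNr.
- move=> r _ [s ->]; exists [seq (r * p.1, p.2) | p <- s].
  by rewrite big_map mulr_sumr; apply: eq_bigr => p _; rewrite /= !mulrA.
- move=> _ r [s ->]; exists [seq (p.1, p.2 * r) | p <- s].
  by rewrite big_map mulr_suml; apply: eq_bigr => p _; rewrite /= !mulrA.
Qed.

Lemma mem_principal_ideal a : principal_ideal a a.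
Proof. by exists [:: (1, 1)]; rewrite big_seq1 /= mul1r mulr1. Qed.

(** Products from the ideals generated by [x] and [y] expand into terms [b * (x * r * y) * c], all
    in [P], so primeness puts one of these two ideals inside [P]. *)
Lemma prime_ideal_elt P x y :
  prime_ideal P -> (forall r, P (x * r * y)) -> P x \/ P y.
Proof.
move=> [idP _ primeP] Pxy.
have [PL PR] : (forall r z, P z -> P (r * z)) /\ (forall z r, P z -> P (z * r)).
  by case: idP.
have [|sub|sub] := primeP _ _ (two_sided_principal_ideal x)
                          (two_sided_principal_ideal y).
- move=> _ [s Hs ->]; apply: two_sided_ideal_sum => // p /Hs[[t ->] [u ->]].
  rewrite mulr_suml; apply: two_sided_ideal_sum => // q _.
  rewrite mulr_sumr; apply: two_sided_ideal_sum => // q' _.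
  have -> : q.1 * x * q.2 * (q'.1 * y * q'.2) =
            q.1 * (x * (q.2 * q'.1) * y) * q'.2 by rewrite !mulrA.
  by apply: PR; apply: PL.
- by left; apply/sub/mem_principal_ideal.
- by right; apply/sub/mem_principal_ideal.
Qed.

Lemma lower_nilradical_sub_nilpotent :
  lower_nilradical R `<=` nilpotent_elts R.
Proof.
move=> a nil_a; apply: contrapT => not_nil.
have pow0 n : (0 < n)%N -> a ^+ n != 0.
  by move=> n0; apply/eqP => an0; apply: not_nil; exists n.
(* [I 0] is left out so that the union of the empty chain qualifies. *)
pose good I := [/\ forall x y, I x -> I y -> I (x - y),
  forall r x, I x -> I (r * x), forall x r, I x -> I (x * r)
  & forall n, (0 < n)%N -> ~ I (a ^+ n)].
have [|P [[PB PL PR Pa] Pmax]] := @Zorn_bigcup R good.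
  move=> F Fgood Ftot; split.
  - move=> x y [X FX Xx] [Y FY Yy].
    have [XY|YX] := Ftot _ _ FX FY.
    + by exists Y => //; case: (Fgood _ FY) => YB _ _ _; apply/YB/Yy/XY.
    + by exists X => //; case: (Fgood _ FX) => XB _ _ _; apply/XB/YX/Yy.
  - by move=> r x [X FX Xx]; exists X => //; case: (Fgood _ FX) => _ + _ _; apply.
  - by move=> x r [X FX Xx]; exists X => //; case: (Fgood _ FX) => _ _ + _; apply.
  - by move=> n n0 [X FX]; case: (Fgood _ FX) => _ _ _; apply.
(* Closure under subtraction makes [P] empty if it misses [0]; then [[set 0]] is a strictly larger
   good set. *)
have P0 : P 0.
  apply: contrapT => nP0; apply: (Pmax [set 0]).
    split=> [x Px|sub]; last exact/nP0/sub.
    by case: nP0; rewrite -(subrr x); apply: PB.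
  split=> [x y -> ->|r x ->|x r ->|n n0 /eqP].
  - exact: subr0.
  - exact: mulr0.
  - exact: mul0r.
  - exact/negP/pow0.
have idP : two_sided_ideal P by [].
(* Adding [I] strictly enlarges [P], so by maximality the sum is not good; being an ideal, it can
   only fail by containing a power of [a]. *)
have max_pow I : two_sided_ideal I -> ~ (I `<=` P) ->
    exists2 n, (0 < n)%N & ideal_add P I (a ^+ n).
  move=> idI nIP; apply: contrapT => no_pow; apply: (Pmax (ideal_add P I)).
    split=> [x Px|sub].
      by exists x, 0; rewrite addr0; split=> //; case: idI.
    by apply: nIP => x Ix; apply: sub; exists 0, x; rewrite add0r.
  have [_ SB SL SR] := two_sided_ideal_add idP idI.
  by split=> // n n0 Sn; apply: no_pow; exists n.
apply: (Pa 1%N) => //; rewrite expr1; apply: nil_a; split=> //.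
  by apply/eqP => PT; apply: (Pa 1%N) => //; rewrite PT.
move=> I J idI idJ IJP; apply: contrapT => /not_orP[nIP nJP].
have [i i0 [x [u [Px Iu ai]]]] := max_pow I idI nIP.
have [j j0 [y [v [Py Jv aj]]]] := max_pow J idJ nJP.
apply: (Pa (i + j)%N); first by rewrite addn_gt0 i0.
(* Modulo [P], [a ^+ i * a ^+ j] reduces to [u * v], which lies in the product of [I] and [J]. *)
rewrite exprD aj mulrDr; apply: two_sided_idealD => //; first exact: PL.
rewrite ai mulrDl; apply: two_sided_idealD => //; first exact: PR.
apply: IJP; exists [:: (u, v)]; last by rewrite big_seq1.
by move=> p; rewrite inE => /eqP->.
Qed.

End Ideals.

Section WeaklyReversible.
Variable R : pzRingType.
Hypothesis hR : weakly_reversible R.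
Implicit Types (a x z : R) (P : set R).

Lemma square_zero_reversible z : z * z = 0 -> reversible_elt z.
Proof.
move=> zz; have [->|/hR[m [m_gt0 zm_neq0 rev]]] := eqVneq z 0.
  by apply/seteqP; split=> x _; [exact: mul0r|exact: mulr0].
(* Powers of [z] from the second on vanish, so the reversible power is [z] itself. *)
case: m m_gt0 zm_neq0 rev => [|[|m]] // _.
by rewrite !exprS mulrA zz mul0r eqxx.
Qed.

Lemma square_zero_annihilator z a r : z * z = 0 -> a * z = 0 -> z * r * a = 0.
Proof.
move=> /square_zero_reversible rev az.
have : left_annihilator z (r * a) by rewrite /left_annihilator /= -mulrA az mulr0.
by rewrite rev /right_annihilator /= mulrA.
Qed.

(** The factor [x] stays general because the induction on [k] replaces it by [x * a * r]. *)
Lemma prime_ideal_mem_of_exprM P a k x :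
  prime_ideal P -> a ^+ k * (x * a) = 0 -> P (x * a).
Proof.
move=> primeP; have [[P0 _ PL PR] _ _] := primeP.
elim: k x => [x|k IHk x]; first by rewrite mul1r => ->.
rewrite exprS -mulrA; set z := a ^+ k * _ => az.
(* The left copy of [z] ends in [a], which kills the right copy. *)
have zz : z * z = 0 by rewrite {1}/z -!mulrA az !mulr0.
have [r|//|/PL//] := @prime_ideal_elt _ P (x * a) a primeP.
by apply: IHk; rewrite !mulrA -(mulrA _ x a); apply: square_zero_annihilator.
Qed.

Lemma nilpotent_sub_lower_nilradical :
  nilpotent_elts R `<=` lower_nilradical R.
Proof.
move=> a [n _ an0] P primeP; rewrite -[a]mul1r.
by apply: (@prime_ideal_mem_of_exprM P a n 1) => //; rewrite an0 mul0r.
Qed.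

End WeaklyReversible.

Theorem mainTheorem5 (R : pzRingType) (hR : weakly_reversible R) :
  lower_nilradical R = nilpotent_elts R /\ two_primal R.
Proof.
suff eqN : lower_nilradical R = nilpotent_elts R by [].
apply/seteqP; split; first exact: lower_nilradical_sub_nilpotent.
exact: nilpotent_sub_lower_nilradical.
Qed.
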